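(* Let $n \ge 1$ and let $M$ be any $n$-element multiset of integers taken from $[n]$. Let $S$ be any given set. Then the permutations of $M$ whose set of cyclic points is $S$ are in bijection with the permutations of $M$ whose set of terminal closers is $S$.
   Context: $[n]=\{1,\dots,n\}$. A permutation of the multiset $M$ (multiset permutation) is a sequence $w=(w_1,\dots,w_n)$ such that, for each $j$, the multiplicity of $j$ in $M$ is $|\{i: w_i=j\}|$. The digraph $G_w$ has vertex set $[n]$ and edges $i\to w_i$ for $i\in[n]$. A cyclic point of $w$ is a vertex lying on a directed cycle of $G_w$ (fixed points, i.e. loops, count as cycles of length $1$). The set of terminal closers of $w$ is the set of values $\{w_1,\dots,w_k\}$ of the maximal initial segment of distinct terms of $w$: that is, $w_1,\dots,w_k$ are pairwise distinct but $w_{k+1}=w_i$ for some $i\in[k]$; if $w_1,\dots,w_n$ are all distinct, then $k=n$. *)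

(* Defs.v *)
From mathcomp Require Import all_boot.
From mathcomp Require Export finmap multiset.

Set Implicit Arguments.
Unset Strict Implicit.
Unset Printing Implicit Defensive.

Local Open Scope mset_scope.

(* The set [n] = {1, ..., n} is encoded as 'I_n = {0, ..., n - 1}, both for the
   positions and for the values of a word; the i-th term of w is tnth w i. *)

Definition multiset_perm (n : nat) (M : {mset 'I_n}) (w : n.-tuple 'I_n) :
  bool :=
  [forall j : 'I_n, #|[set i : 'I_n | tnth w i == j]| == M j].

Definition word_digraph (n : nat) (w : n.-tuple 'I_n) : rel 'I_n :=
  fun i j => tnth w i == j.

(* A directed cycle has distinct vertices, so sequences of size at most n
   suffice (see cyclic_pointP); membership of x makes the cycle nonempty, and
   [:: x] is a cycle exactly when there is a loop at x. *)
Definition cyclic_point (n : nat) (w : n.-tuple 'I_n) (x : 'I_n) : bool :=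
  [exists c : n.-bseq 'I_n, ucycleb (word_digraph w) c && (x \in c)].

Definition cyclic_points (n : nat) (w : n.-tuple 'I_n) : {set 'I_n} :=
  [set x | cyclic_point w x].

Lemma cyclic_pointP (n : nat) (w : n.-tuple 'I_n) (x : 'I_n) :
  reflect (exists2 c : seq 'I_n, ucycle (word_digraph w) c & x \in c)
          (cyclic_point w x).
Proof.
apply: (iffP existsP) => [[c /andP[cyc_c xc]]|[c cyc_c xc]]; first by exists c.
have sz_c : size c <= n.
  by have /andP[_ /card_uniqP <-] := cyc_c; rewrite -[n in _ <= n]card_ord max_card.
by exists (Bseq sz_c); apply/andP.
Qed.

(* The length of the maximal initial segment of w with distinct terms. *)
Definition closer_length (n : nat) (w : n.-tuple 'I_n) : nat :=
  \max_(k < n.+1 | uniq (take k w)) k.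

Definition terminal_closers (n : nat) (w : n.-tuple 'I_n) : {set 'I_n} :=
  [set x in take (closer_length w) w].

Lemma closer_length_le (n : nat) (w : n.-tuple 'I_n) : closer_length w <= n.
Proof. by apply/bigmax_leqP => k _; rewrite -ltnS. Qed.

Lemma closer_length_uniq (n : nat) (w : n.-tuple 'I_n) :
  uniq (take (closer_length w) w).
Proof.
rewrite /closer_length; elim/big_ind: _ => [|k l uk ul|k //].
  by rewrite take0.
by rewrite /maxn; case: ifP.
Qed.

Lemma closer_length_repeat (n : nat) (w : n.-tuple 'I_n) (i : 'I_n) :
  i = closer_length w :> nat -> tnth w i \in take (closer_length w) w.
Proof.
move=> def_i; apply: contraT => new_i.
have lt_in : i < size w by rewrite size_tuple.
have: uniq (take i.+1 w).
  rewrite (take_nth (tnth w i)) // rcons_uniq -tnth_nth def_i new_i.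
  exact: closer_length_uniq.
have lt_i : i.+1 < n.+1 by rewrite ltnS.
move=> ui; have := @leq_bigmax_cond _ (fun k : 'I_n.+1 => uniq (take k w))
  (@nat_of_ord _) (Ordinal lt_i) ui.
by rewrite /= -/(closer_length w) -def_i ltnn.
Qed.

(* Main.v *)
(* It suffices to count. View w as the map x |-> w_x. The cyclic points of w form
   S iff w permutes S and has no cycle in A = ~: S; after permuting the positions
   so that the first #|S| of them become S and the next one a vertex h of A, the
   terminal closers form S iff w permutes S and w_h lies outside A. So fix w
   outside A, and fix the content of w: this determines which vertices l of A are
   leaves, i.e. are not taken as values on A. If there is a leaf l, both counts
   are sums over w_l of the same counts for A :\ l, since a leaf lies on no cycle
   and is not w_h; if there is none, w permutes A and both counts vanish. *)

Require Import Defs.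
From mathcomp Require Import all_boot.
From mathcomp Require Import fingroup perm.

Local Open Scope mset_scope.

(** * Fibrewise counting and reordering of positions *)

(** Indexing the fibres by points [g] equips each of them with a reference point; a value that [k]
    does not take has an empty fibre. *)
Lemma eq_card_fibers {aT rT : finType} (k : aT -> rT) (P Q : pred aT) :
    (forall g, #|[set x | P x && (k x == k g)]| =
               #|[set x | Q x && (k x == k g)]|) ->
  #|[set x | P x]| = #|[set x | Q x]|.
Proof.
move=> eqPQ; rewrite -!sum1dep_card.
rewrite (partition_big k xpredT) // [RHS](partition_big k xpredT) //.
apply: eq_bigr => y _; rewrite !sum1dep_card.
have [g /eqP <-|no_y] := pickP (fun g => k g == y); first exact: eqPQ.
by apply: eq_card => x; rewrite !inE no_y !andbF.
Qed.

Lemma ex_bijective {aT rT : finType} :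
  #|aT| = #|rT| -> exists f : aT -> rT, bijective f.
Proof.
move=> eqc; exists (fun x => enum_val (cast_ord eqc (enum_rank x))).
exists (fun y => enum_val (cast_ord (esym eqc) (enum_rank y))) => x.
  by rewrite enum_valK cast_ordK enum_rankK.
by rewrite enum_valK cast_ordKV enum_rankK.
Qed.

(** Listing [S] first and its complement next gives [s], which turns a condition on the first [#|S|]
    positions into one on the positions in [S]. *)
Lemma perm_to_initial {n : nat} (S : {set 'I_n}) :
  exists s : {perm 'I_n}, forall i, (s i \in S) = (i < #|S|).
Proof.
have: perm_eq (enum S ++ enum (~: S)) (ord_tuple n).
  apply: uniq_perm => [||x]; last first.
  - by rewrite mem_cat !mem_enum inE orbN.
  - by rewrite val_ord_tuple enum_uniq.
  - rewrite cat_uniq !enum_uniq /= andbT; apply/hasPn => x.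
    by rewrite !mem_enum inE.
case/tuple_permP=> s def_s; exists s => i.
have -> : s i = nth i (enum S ++ enum (~: S)) i.
  by rewrite def_s -tnth_nth tnth_mktuple tnth_ord_tuple.
rewrite nth_cat -cardE; case: ltnP => [lt_i|le_i].
  by rewrite -mem_enum mem_nth -?cardE.
apply/negbTE; rewrite -in_setC -mem_enum mem_nth // -cardE.
by rewrite [#|~: S|]cardsCs setCK card_ord ltn_sub2r // (leq_ltn_trans le_i).
Qed.

Definition reindex {n : nat} (s : {perm 'I_n}) (w : n.-tuple 'I_n) :
    n.-tuple 'I_n :=
  [tuple tnth w (s i) | i < n].

Lemma tnth_reindex {n : nat} (s : {perm 'I_n}) (w : n.-tuple 'I_n) i :
  tnth (reindex s w) i = tnth w (s i).
Proof. exact: tnth_mktuple. Qed.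

Lemma card_reindex {n : nat} (s : {perm 'I_n}) (P : pred (n.-tuple 'I_n)) :
  #|[set w | P (reindex s w)]| = #|[set w | P w]|.
Proof.
rewrite -[RHS](card_preimset (f := reindex s)).
  by apply: eq_card => w; rewrite !inE.
move=> v w eq_vw; apply: eq_from_tnth => i.
by rewrite -[i](permKV s) -!tnth_reindex eq_vw.
Qed.

Lemma multiset_perm_reindex {n : nat} (M : {mset 'I_n}) s w :
  multiset_perm M (reindex s w) = multiset_perm M w.
Proof.
apply: eq_forallb => j; rewrite -[in RHS](card_preimset (f := s)); last exact: perm_inj.
by congr (_ == _); apply: eq_card => i; rewrite !inE tnth_reindex.
Qed.

(** * Words with prescribed letters outside a vertex set *)

Definition restr_off {n : nat} (A : {set 'I_n}) (w : n.-tuple 'I_n) :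
    {ffun 'I_n -> option 'I_n} :=
  [ffun x => if x \in A then None else Some (tnth w x)].

Lemma restr_offP {n : nat} (A : {set 'I_n}) (v w : n.-tuple 'I_n) :
  reflect (forall x, x \notin A -> tnth v x = tnth w x)
          (restr_off A v == restr_off A w).
Proof.
apply: (iffP eqP) => [/ffunP eq_vw x xNA|eq_vw].
  by have := eq_vw x; rewrite !ffunE (negbTE xNA) => -[].
by apply/ffunP => x; rewrite !ffunE; case: ifPn => // /eq_vw ->.
Qed.

Lemma restr_offS {n : nat} {A B : {set 'I_n}} {v w : n.-tuple 'I_n} :
  A \subset B -> restr_off A v == restr_off A w ->
  restr_off B v == restr_off B w.
Proof.
move=> sAB /restr_offP eq_vw; apply/restr_offP => x xNB.
by apply: eq_vw; apply: contra xNB; apply: (subsetP sAB).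
Qed.

(* A vertex set B is contained in its image iff w permutes B, that is, iff B is
   a union of cycles. *)
Definition acyclic_on {n : nat} (A : {set 'I_n}) (w : n.-tuple 'I_n) : bool :=
  [forall B : {set 'I_n},
    (B \subset A) && (B \subset [set tnth w x | x in B]) ==> (B == set0)].

Lemma acyclic_onP {n : nat} (A : {set 'I_n}) (w : n.-tuple 'I_n) :
  reflect (forall B : {set 'I_n}, B \subset A ->
             B \subset [set tnth w x | x in B] -> B = set0)
          (acyclic_on A w).
Proof.
apply: (iffP forallP) => [acA B sBA sBw|acA B].
  by have := acA B; rewrite sBA sBw => /eqP.
by apply/implyP => /andP[sBA sBw]; apply/eqP/acA.
Qed.

(** A subset of [A] contained in its own image consists of values taken on [A], so it avoids [l]
    anyway. *)
Lemma acyclic_onD1 {n : nat} (A : {set 'I_n}) (w : n.-tuple 'I_n) l :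
    l \notin [set tnth w x | x in A] ->
  acyclic_on (A :\ l) w = acyclic_on A w.
Proof.
move=> lNw; apply/acyclic_onP/acyclic_onP => acA B sBA sBw; apply: acA => //.
  rewrite subsetD1 sBA /=; apply: contra lNw => /(subsetP sBw).
  exact/subsetP/imsetS.
by apply: subset_trans sBA (subsetDl _ _).
Qed.

(** The letter [l] occurs [M l] times in all, and its occurrences outside [A] can be read off [g];
    any surplus must sit on [A]. *)
Lemma mem_image_content {n : nat} {M : {mset 'I_n}} {A : {set 'I_n}}
    {g w : n.-tuple 'I_n} l :
    multiset_perm M w -> restr_off A w == restr_off A g ->
  (l \in [set tnth w x | x in A]) = (#|[set x in ~: A | tnth g x == l]| < M l).
Proof.
move=> /forallP/(_ l)/eqP <- /restr_offP eq_wg.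
rewrite -(cardsID A [set x | tnth w x == l]) addnC.
have -> : [set x in ~: A | tnth g x == l] = [set x | tnth w x == l] :\: A.
  by apply/setP=> x; rewrite !inE; case: (boolP (x \in A)) => //= /eq_wg ->.
rewrite -[ltnLHS]addn0 ltn_add2l card_gt0.
apply/imsetP/set0Pn => [[x xA ->]|[x]].
  by exists x; rewrite !inE eqxx.
by rewrite !inE => /andP[/eqP <- xA]; exists x.
Qed.

(** Both [h] and [g] stay general for the induction: [h] may be the removed leaf, and each letter
    chosen at the leaf gives a new [g]. *)
Lemma card_forests {n : nat} (M : {mset 'I_n}) (A : {set 'I_n}) (h : 'I_n) g :
    h \in A ->
  #|[set w | multiset_perm M w && acyclic_on A w
             && (restr_off A w == restr_off A g)]| =
  #|[set w | multiset_perm M w && (tnth w h \notin A)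
             && (restr_off A w == restr_off A g)]|.
Proof.
have [m] := ubnP #|A|; elim: m A h g => // m IHm A h g /ltnSE le_A_m hA.
have [l /andP[lA leaf_l]|no_leaf] := pickP (fun l => (l \in A) &&
  (M l <= #|[set x in ~: A | tnth g x == l]|)); last first.
  have sAw w : multiset_perm M w -> restr_off A w == restr_off A g ->
      A \subset [set tnth w x | x in A].
    move=> Mw wg; apply/subsetP => l lA; rewrite (mem_image_content _ Mw wg).
    by have := no_leaf l; rewrite lA leqNgt /= => /negbFE.
  (* Both sets are empty: [A] itself refutes acyclicity, and [w] permutes [A], so it cannot send [h]
     outside. *)
  apply: eq_card => w; rewrite !inE; apply/andP/andP=> -[/andP[Mw ac] wg];
    have sAwA := sAw w Mw wg.
    by move/acyclic_onP/(_ A (subxx A) sAwA): ac => A0; rewrite A0 inE in hA.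
  have /eqP defA : A == [set tnth w x | x in A].
    by rewrite eqEcard sAwA leq_imset_card.
  by case/negP: ac; rewrite defA imset_f.
have lNw w : multiset_perm M w -> restr_off A w == restr_off A g ->
    l \notin [set tnth w x | x in A].
  by move=> Mw wg; rewrite (mem_image_content _ Mw wg) -leqNgt.
have lt_Al_m : #|A :\ l| < m by move: le_A_m; rewrite (cardsD1 l A) lA.
have [A1|[h' h'Al]] := set_0Vmem (A :\ l).
  (* Both conditions hold on the whole fibre: removing [l] leaves no vertex, and [l] is not a value
     on [A]. *)
  have defA : A = [set l] by rewrite -(setD1K lA) A1 setU0.
  apply: eq_card => w; rewrite !inE.
  case Mw: (multiset_perm M w) => //=.
  case wg: (restr_off A w == _); rewrite ?andbF ?andbT //.
  have lNwA := lNw w Mw wg.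
  rewrite -(acyclic_onD1 _ _ _ lNwA) A1.
  have -> : acyclic_on set0 w.
    by apply/acyclic_onP => B; rewrite subset0 => /eqP.
  by apply/esym; rewrite defA inE; apply: contra lNwA => /eqP <-; rewrite imset_f.
(* The first-letter condition does not depend on the position h, which can
   therefore be moved away from the leaf l. *)
transitivity #|[set w | multiset_perm M w && (tnth w h' \notin A)
                        && (restr_off A w == restr_off A g)]|; last first.
  have [h'Nl h'A] := setD1P h'Al.
  rewrite -(card_reindex (tperm h h')); apply: eq_card => w; rewrite !inE.
  rewrite multiset_perm_reindex tnth_reindex tpermR.
  congr (_ && _); apply/restr_offP/restr_offP => wg x xNA; rewrite -wg //.
    by rewrite tnth_reindex tpermD //; apply: contraNneq xNA => <-.
  by rewrite tnth_reindex tpermD //; apply: contraNneq xNA => <-.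
(* This sums over the letter at [l]; a [v] that disagrees with [g] off [A] leaves nothing to
   count. *)
apply: (eq_card_fibers (restr_off (A :\ l))) => v.
have sAl : A :\ l \subset A := subsetDl _ _.
have [vg|vNg] := boolP (restr_off A v == restr_off A g); last first.
  apply: eq_card => w; rewrite !inE; apply/andP/andP => -[/andP[_ wg] wv];
  by case/negP: vNg; rewrite -(eqP wg) eq_sym (restr_offS sAl).
transitivity #|[set w | multiset_perm M w && acyclic_on (A :\ l) w
                        && (restr_off (A :\ l) w == restr_off (A :\ l) v)]|.
  apply: eq_card => w; rewrite !inE.
  case Mw: (multiset_perm M w) => //=.
  case wv: (restr_off (A :\ l) w == _); rewrite ?andbF ?andbT //.
  have wg : restr_off A w == restr_off A g.
    by rewrite -(eqP vg) (restr_offS sAl).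
  by rewrite wg andbT acyclic_onD1 // lNw.
rewrite (IHm _ h') //; apply: eq_card => w; rewrite !inE.
case Mw: (multiset_perm M w) => //=.
case wv: (restr_off (A :\ l) w == _); rewrite ?andbF ?andbT //.
have wg : restr_off A w == restr_off A g.
  by rewrite -(eqP vg) (restr_offS sAl).
(* The letter at [h'] is not [l], so avoiding [A :\ l] and avoiding [A] are the same for it. *)
rewrite wg andbT; case: eqP => //= wh'.
apply/esym/negP => _; case/negP: (lNw w Mw wg); rewrite -wh' imset_f //.
by case/setD1P: h'Al.
Qed.

(** * Cyclic points and terminal closers as conditions on a word *)

Lemma eq_cyclic_points {n : nat} (w : n.-tuple 'I_n) (S : {set 'I_n}) :
  (cyclic_points w == S) =
  ([set tnth w x | x in S] == S) && acyclic_on (~: S) w.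
Proof.
(* By cardinality [B] equals its image, so [w] is injective on [B] and the orbit of each of its
   points is a cycle. *)
have sub_cyc (B : {set 'I_n}) : B \subset [set tnth w x | x in B] ->
    B \subset cyclic_points w.
  move=> sBw; have /eqP defB : B == [set tnth w x | x in B].
    by rewrite eqEcard sBw leq_imset_card.
  have injB : {in B &, injective (tnth w)} by apply/imset_injP; rewrite -defB.
  have homB : {homo tnth w : x / x \in B}.
    by move=> x xB; rewrite defB imset_f.
  apply/subsetP => x xB; rewrite inE; apply/cyclic_pointP.
  exists (fingraph.orbit (tnth w) x); last by rewrite in_orbit.
  by apply/andP; split; [apply: (cycle_orbit_in homB injB) | apply: orbit_uniq].
have stable : [set tnth w x | x in cyclic_points w] = cyclic_points w.
  have cyc_cyc x : x \in cyclic_points w -> exists2 c : seq 'I_n,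
      fcycle (tnth w) c & (x \in c) /\ {subset c <= cyclic_points w}.
    rewrite inE => /cyclic_pointP[c cyc_c xc]; exists c.
      by have /andP[] := cyc_c.
    by split=> // y yc; rewrite inE; apply/cyclic_pointP; exists c.
  apply/setP => y; apply/imsetP/idP => [[x /cyc_cyc[c cyc_c [xc sc]] ->]|].
    by apply: sc; rewrite (eqP (next_cycle cyc_c xc)) mem_next.
  case/cyc_cyc=> c cyc_c [yc sc]; exists (prev c y).
    by apply: sc; rewrite mem_prev.
  by rewrite (eqP (prev_cycle cyc_c yc)).
apply/eqP/andP => [<-|[/eqP wS /acyclic_onP acS]].
  split; first exact/eqP.
  apply/acyclic_onP => B sBC /sub_cyc sB; apply/eqP.
  by rewrite -subset0 -(setICr (cyclic_points w)) subsetI sB.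
have sS : S \subset cyclic_points w by apply: sub_cyc; rewrite wS.
(* A cyclic point outside [S] has a cyclic predecessor, again outside [S] because [w] preserves [S];
   so these points form a set contained in its image. *)
apply/eqP; rewrite eqEsubset sS andbT -setD_eq0; apply/eqP/acS.
  by rewrite setDE subsetIr.
apply/subsetP => y /setDP[]; rewrite -{1}stable => /imsetP[x xc ->] wxNS.
apply: imset_f; rewrite inE xc andbT; apply: contra wxNS => xS.
by rewrite -wS imset_f.
Qed.

Lemma mem_take_tuple {n : nat} (w : n.-tuple 'I_n) (k : nat) y :
  (y \in take k w) = (y \in [set tnth w i | i in [set i : 'I_n | i < k]]).
Proof.
apply/(nthP y)/imsetP => [[i]|[i]].
  rewrite size_take_min leq_min size_tuple => /andP[lt_ik lt_in] <-.
  exists (Ordinal lt_in); first by rewrite inE.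
  by rewrite nth_take // (tnth_nth y).
rewrite inE => lt_ik def_y; exists i; last first.
  by rewrite nth_take // -tnth_nth -def_y.
by rewrite size_take_min leq_min lt_ik size_tuple ltn_ord.
Qed.

(** The first [#|S|] terms fill [S], hence are distinct, and the next term repeats one of them. For
    [#|S| = n] there is no next term and the second condition is vacuous. *)
Lemma eq_terminal_closers {n : nat} (w : n.-tuple 'I_n) (S : {set 'I_n}) :
  (terminal_closers w == S) =
  ([set tnth w i | i in [set i : 'I_n | i < #|S|]] == S) &&
  [forall i : 'I_n, (i == #|S| :> nat) ==> (tnth w i \in S)].
Proof.
have size_take_w k : k <= n -> size (take k w) = k.
  by move=> le_kn; rewrite size_take_min size_tuple; apply/minn_idPl.
have le_Sn : #|S| <= n by rewrite -[n in _ <= n]card_ord max_card.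
apply/eqP/andP => [defS|[/eqP wS /forallP repS]].
  have memS x : (x \in S) = (x \in take (closer_length w) w).
    by rewrite -defS inE.
  have eqS : #|S| = closer_length w.
    rewrite (eq_card memS) (card_uniqP (closer_length_uniq w)).
    by rewrite size_take_w // closer_length_le.
  split; first by apply/eqP/setP => x; rewrite memS eqS mem_take_tuple.
  apply/forallP => i; apply/implyP => /eqP def_i.
  by rewrite memS closer_length_repeat -?eqS.
have mem_take x : (x \in take #|S| w) = (x \in S) by rewrite mem_take_tuple wS.
suff eqS : closer_length w = #|S| by apply/setP => x; rewrite inE eqS mem_take.
apply/eqP; rewrite eqn_leq; apply/andP; split; last first.
  have uS : uniq (take #|S| w).
    by apply/card_uniqP; rewrite (eq_card mem_take) size_take_w.
  exact: (@leq_bigmax_cond _ (fun k : 'I_n.+1 => uniq (take k w))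
    (@nat_of_ord _) (Ordinal (le_Sn : #|S| < n.+1)) uS).
(* A longer distinct segment would include the next term, which lies in [S] and so has already
   occurred. *)
rewrite leqNgt; apply/negP => lt_S.
have lt_Sn := leq_trans lt_S (closer_length_le w).
have := repS (Ordinal lt_Sn); rewrite eqxx -mem_take; apply/negP.
have: uniq (take #|S|.+1 w).
  by have := closer_length_uniq w; rewrite -(subnKC lt_S) takeD cat_uniq => /andP[].
rewrite (take_nth (tnth w (Ordinal lt_Sn))) ?size_tuple // rcons_uniq.
by rewrite -[nth _ _ _]/(nth _ w (Ordinal lt_Sn)) -tnth_nth => /andP[].
Qed.

(** * Comparison of the two counts *)

Theorem theorem5 (n : nat) (hn : 1 <= n) (M : {mset 'I_n})
    (hM : size M = n) (S : {set 'I_n}) :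
  exists f : {w : n.-tuple 'I_n | multiset_perm M w && (cyclic_points w == S)} ->
             {w : n.-tuple 'I_n | multiset_perm M w && (terminal_closers w == S)},
    bijective f.
Proof.
apply: ex_bijective; rewrite !card_sig -[LHS]cardsE -[RHS]cardsE.
have [s sS] := perm_to_initial S.
have imP : [set s i | i in [set i : 'I_n | i < #|S|]] = S.
  apply/setP => y; apply/imsetP/idP => [[i]|yS].
    by rewrite inE -sS => siS ->.
  by exists ((s^-1)%g y); rewrite ?permKV // inE -sS permKV.
rewrite -[RHS](card_reindex s).
(* The repetition condition on terminal closers, after reordering by [s]. *)
pose Q (w : n.-tuple 'I_n) :=
  [forall i : 'I_n, (i == #|S| :> nat) ==> (tnth w (s i) \in S)].
transitivity #|[set w : n.-tuple 'I_n | multiset_perm M w &&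
    (([set tnth w x | x in S] == S) && Q w)]|; last first.
  apply: eq_card => w; rewrite !inE multiset_perm_reindex eq_terminal_closers.
  congr [&& _, _ == _ & _].
    by rewrite (eq_imset _ (tnth_reindex s w)) (imset_comp (tnth w) s) imP.
  by apply: eq_forallb => i; rewrite tnth_reindex.
transitivity #|[set w : n.-tuple 'I_n | multiset_perm M w &&
    (([set tnth w x | x in S] == S) && acyclic_on (~: S) w)]|.
  by apply: eq_card => w; rewrite !inE eq_cyclic_points.
(* A fibre fixes the letters on [S], which decides whether [w] permutes [S]. *)
apply: (eq_card_fibers (restr_off (~: S))) => g.
have imS w : restr_off (~: S) w == restr_off (~: S) g ->
    [set tnth w x | x in S] = [set tnth g x | x in S].
  move/restr_offP=> wg; apply: eq_in_imset => x xS.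
  by rewrite wg // inE negbK.
have [gS|gNS] := eqVneq [set tnth g x | x in S] S; last first.
  apply: eq_card => w; rewrite !inE.
  case wg: (restr_off _ w == _); rewrite ?andbF //.
  by rewrite imS // (negbTE gNS) !andbF.
transitivity #|[set w | multiset_perm M w && acyclic_on (~: S) w
                        && (restr_off (~: S) w == restr_off (~: S) g)]|.
  apply: eq_card => w; rewrite !inE.
  case wg: (restr_off _ w == _); rewrite ?andbF //.
  by rewrite imS // gS eqxx.
have [lt_Sn|le_nS] := ltnP #|S| n.
  (* The only position that [Q] constrains; it lies outside [S]. *)
  pose h := s (Ordinal lt_Sn).
  have hNS : h \in ~: S by rewrite inE sS ltnn.
  rewrite (card_forests _ _ h) //; apply: eq_card => w; rewrite !inE.
  case wg: (restr_off _ w == _); rewrite ?andbF //.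
  rewrite imS // gS eqxx negbK !andbT /=; congr (_ && _).
  apply/idP/forallP => [whS i|/(_ (Ordinal lt_Sn))]; last by rewrite eqxx.
  by apply/implyP => /eqP iS; rewrite (_ : i = Ordinal lt_Sn) //; apply: val_inj.
(* With no vertex outside [S], acyclicity and [Q] are both vacuous. *)
have S_T : ~: S = set0.
  by apply/eqP; rewrite -cards_eq0 cardsCs setCK card_ord subn_eq0.
apply: eq_card => w; rewrite !inE.
case wg: (restr_off _ w == _); rewrite ?andbF //.
rewrite imS // gS eqxx !andbT /=; congr (_ && _).
transitivity true; last first.
  apply/esym/forallP => i; apply/implyP => /eqP iS.
  by have := ltn_ord i; rewrite iS ltnNge le_nS.
by apply/acyclic_onP => B; rewrite S_T subset0 => /eqP.
Qed.
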